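(* There is an absolute constant $C>0$ such that for every $0<\delta\leq 1$ and every integer $d\geq 1$, every $n$-vertex trigraph $T$ with minimum degree at least $\delta n$ and VC-dimension at most $d$ has domination number $\gamma(T)\leq C\cdot\frac{d}{\delta}\ln\frac{2}{\delta}$.
   Context: A trigraph is $T=(V,E,R)$ where $V$ is a finite vertex set, $E$ (plain edges) and $R$ (red edges) are disjoint sets of unordered pairs of distinct vertices. For $v\in V$: $N(v)$ is the set of plain neighbours, $N[v]=N(v)\cup\{v\}$, $R(v)$ the set of red neighbours. The minimum degree is $\min_v|N(v)|$. A dominating set is a set $X$ such that every $y\in V$ lies in $N[x]\cup R(x)$ for some $x\in X$; $\gamma(T)$ is the minimum size of a dominating set. A set $X\subseteq V$ is shattered if there is a set $S$ of $2^{|X|}$ vertices, none having a red neighbour in $X$, such that for every $Y\subseteq X$ some $v_Y\in S$ has $N[v_Y]\cap X=Y$. The VC-dimension of $T$ is the largest size of a shattered set. *)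

(* Defs.v *)
From mathcomp Require Import all_boot.
From Stdlib Require Import Reals.
Set Implicit Arguments. Unset Strict Implicit. Unset Printing Implicit Defensive.

(* A trigraph on the finite vertex type V: plain edges E and red edges R,
   both symmetric irreflexive relations (unordered pairs of distinct vertices),
   and disjoint. *)
Record trigraph (V : finType) := Trigraph {
  tg_E : rel V;
  tg_R : rel V;
  tg_E_sym : symmetric tg_E;
  tg_R_sym : symmetric tg_R;
  tg_E_irr : irreflexive tg_E;
  tg_R_irr : irreflexive tg_R;
  tg_ER_disj : forall x y, tg_E x y -> ~~ tg_R x y
}.

Section TrigraphDefs.
Variables (V : finType) (T : trigraph V).

Definition Nbh (v : V) : {set V} := [set u | tg_E T v u].
Definition CNbh (v : V) : {set V} := v |: Nbh v.
Definition RNbh (v : V) : {set V} := [set u | tg_R T v u].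

(* minimum degree min_v |N(v)| (0 on an empty vertex set) *)
Definition min_degree : nat := \big[minn/#|V|]_(v : V) #|Nbh v|.

Definition dominating (X : {set V}) : bool :=
  [forall y : V, [exists x in X, y \in CNbh x :|: RNbh x]].

(* domination number: minimum size of a dominating set (setT is dominating) *)
Definition domination_number : nat :=
  \big[minn/#|V|]_(X : {set V} | dominating X) #|X|.

Definition shattered (X : {set V}) : bool :=
  [exists S : {set V},
    [&& #|S| == 2 ^ #|X|,
        [forall v in S, [forall x in X, ~~ tg_R T v x]] &
        [forall Y : {set V}, (Y \subset X) ==>
            [exists v in S, CNbh v :&: X == Y]]]].

Definition vc_dim : nat := \max_(X : {set V} | shattered X) #|X|.

End TrigraphDefs.

(* Main.v *)
Require Import Defs.
From mathcomp Require Import all_boot.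
From Stdlib Require Import Reals.
From mathcomp Require Import ssrnat zify.
From Stdlib Require Import Lra.

(* A vertex v is the partial 0/1 function equal to 1 on N[v], undefined on R(v)
   and 0 elsewhere; a word z of t vertices fails to dominate iff some v in G = V
   vanishes on z.  Sauer's lemma does not bound the number of partial patterns,
   so the usual union bound over a double sample is replaced by a potential:
   the number s_t(G) of subsets of positions, summed over all words of length t,
   that are shattered by G.  It is superadditive when G is split by the value at
   one letter, and it shows by induction on t that the number of words missing
   some v in G is at most (1 - k / 2n)^t s_t(G), where n = |V| and k is the
   minimum degree.  Only position sets of size at most d are shattered, so for
   t of order (d / delta) ln (2 / delta) not all n^t words can miss a vertex. *)

(** * Minima as iterated [minn] *)

Lemma bigminn_le_idx (I : Type) (r : seq I) (P : pred I) (F : I -> nat) (m : nat) :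
  \big[minn/m]_(i <- r | P i) F i <= m.
Proof.
elim: r => [|i r IHr]; first by rewrite big_nil.
by rewrite big_cons; case: ifP => // _; rewrite geq_min IHr orbT.
Qed.

Lemma bigminn_le_cond (I : eqType) (r : seq I) (P : pred I) (F : I -> nat)
    (m : nat) (i : I) :
  i \in r -> P i -> \big[minn/m]_(j <- r | P j) F j <= F i.
Proof.
move=> + Pi; elim: r => // j r IHr; rewrite in_cons big_cons.
case/orP => [/eqP<- | /IHr le_r]; first by rewrite Pi geq_minl.
by case: ifP => // _; rewrite geq_min le_r orbT.
Qed.

(** * Counting position sets of bounded size *)

Fixpoint bitmasks (t : nat) : seq bitseq :=
  if t is t'.+1 then
    map (cons true) (bitmasks t') ++ map (cons false) (bitmasks t')
  else [:: [::]].

Lemma size_bitmasks (t : nat) (m : bitseq) : m \in bitmasks t -> size m = t.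
Proof.
elim: t m => [|t IHt] m; first by rewrite inE => /eqP->.
by rewrite mem_cat => /orP[] /mapP[m' /IHt <- ->].
Qed.

(** The binomial sum of C(t, i) over i <= d; the two recursions below are Pascal's rule. *)
Definition small_masks (t d : nat) : nat :=
  count (fun m : bitseq => count (fun b => b) m <= d) (bitmasks t).

Lemma small_masks0 (t : nat) : small_masks t.+1 0 = small_masks t 0.
Proof.
rewrite /small_masks /= count_cat !count_map.
rewrite (eq_count (a2 := pred0)) ?count_pred0 ?add0n; last by move=> m.
exact: eq_count.
Qed.

Lemma small_masksS (t d : nat) :
  small_masks t.+1 d.+1 = small_masks t d + small_masks t d.+1.
Proof.
by rewrite /small_masks /= count_cat !count_map; congr (_ + _); apply: eq_count.
Qed.

(** Since x <= 1, each of the counted terms C(t, i) x^d is at most C(t, i) x^i, a term of the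
    binomial expansion of (1 + x)^t. Formally an induction along Pascal's rule. *)
Lemma small_masks_bound (x : R) (t d : nat) : (0 < x <= 1)%R ->
  (INR (small_masks t d) * x ^ d <= (1 + x) ^ t)%R.
Proof.
move=> x01; elim: t d => [|t IHt] d.
  have -> : small_masks 0 d = 1 by rewrite /small_masks.
  have : (x ^ d <= 1 ^ d)%R by apply: pow_incr; lra.
  by rewrite pow1 /=; lra.
have pow_ge0 : (0 <= (1 + x) ^ t)%R by apply: pow_le; lra.
case: d => [|d].
  have := IHt 0; rewrite small_masks0 /= => le0.
  have : (0 <= x * (1 + x) ^ t)%R by apply: Rmult_le_pos; lra.
  by lra.
rewrite small_masksS plus_INR.
have := Rmult_le_compat_l x _ _ _ (IHt d); have := IHt d.+1 => /=.
by move=> le1 /(_ ltac:(lra)) le2; lra.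
Qed.

(** * Sums over words, nested so that exposing the first letter is definitional *)

Fixpoint sum_words (V : finType) (t : nat) (f : seq V -> nat) : nat :=
  if t is t'.+1 then \sum_x sum_words V t' (fun z => f (x :: z)) else f [::].

Section SumWords.
Variable V : finType.
Implicit Types (t : nat) (f g : seq V -> nat).

Lemma leq_sum_words t f g : (forall z, size z = t -> f z <= g z) ->
  sum_words V t f <= sum_words V t g.
Proof.
elim: t f g => [|t IHt] f g le_fg /=; first exact: le_fg.
by apply: leq_sum => x _; apply: IHt => z sz; apply: le_fg; rewrite /= sz.
Qed.

Lemma sum_wordsD t f g :
  sum_words V t (fun z => f z + g z) = sum_words V t f + sum_words V t g.
Proof.
elim: t f g => [|t IHt] f g //=.
by rewrite -big_split /=; apply: eq_bigr => x _; rewrite IHt.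
Qed.

Lemma sum_words_sum (I : finType) t (F : I -> seq V -> nat) :
  sum_words V t (fun z => \sum_i F i z) = \sum_i sum_words V t (F i).
Proof.
elim: t F => [|t IHt] F //=.
by rewrite exchange_big /=; apply: eq_bigr => x _; rewrite IHt.
Qed.

Lemma sum_wordsM t c f : sum_words V t (fun z => c * f z) = c * sum_words V t f.
Proof.
elim: t f => [|t IHt] f //=.
by rewrite big_distrr /=; apply: eq_bigr => x _; rewrite IHt.
Qed.

Lemma sum_words_const t c : sum_words V t (fun=> c) = #|V| ^ t * c.
Proof.
elim: t => [|t IHt] /=; first by rewrite mul1n.
by rewrite IHt sum_nat_const expnS mulnA.
Qed.

End SumWords.

(** * Vertices as partial 0/1 functions, and shattered words *)

Section PartialClass.
Variables (V : finType) (T : trigraph V).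
Implicit Types (G : {set V}) (w z : seq V) (t d : nat).

Definition clNbh (v : V) : {set V} := CNbh T v :|: RNbh T v.

Definition ones G (x : V) : {set V} := [set v in G | x \in CNbh T v].
Definition zeros G (x : V) : {set V} := [set v in G | x \notin clNbh v].

Definition missed G z : bool :=
  [exists v in G, all (fun x => x \notin clNbh v) z].

(** Splitting by the value at each letter in turn leaves a vertex of G for every 0/1 pattern on w;
    vertices undefined at a letter are dropped by both branches. *)
Fixpoint shatters G w : bool :=
  if w is x :: w' then shatters (ones G x) w' && shatters (zeros G x) w'
  else G != set0.

Definition nb_shattered G z : nat :=
  count (fun m => shatters G (mask m z)) (bitmasks (size z)).

Lemma onesS G G' x : G \subset G' -> ones G x \subset ones G' x.
Proof.
move=> /subsetP sGG'; apply/subsetP => v.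
by rewrite !inE => /andP[/sGG' -> ->].
Qed.

Lemma zerosS G G' x : G \subset G' -> zeros G x \subset zeros G' x.
Proof.
move=> /subsetP sGG'; apply/subsetP => v.
by rewrite !inE => /andP[/sGG' -> ->].
Qed.

Lemma shattersS G G' w : G \subset G' -> shatters G w -> shatters G' w.
Proof.
elim: w G G' => [|x w IHw] G G' sGG' /=.
  by apply: contra => /eqP G'0; rewrite -subset0 -G'0.
by case/andP => /(IHw _ _ (onesS _ _ x sGG')) -> /(IHw _ _ (zerosS _ _ x sGG')).
Qed.

(** Let A and B be the masks of z shattered by the two classes. Masks in A and B stay shattered by G
    when x is kept, masks in A or B when x is dropped, and |A| + |B| is the size of the intersection
    plus that of the union. *)
Lemma nb_shattered_cons G x z :
  nb_shattered (ones G x) z + nb_shattered (zeros G x) z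
    <= nb_shattered G (x :: z).
Proof.
rewrite /nb_shattered /= count_cat !count_map -count_predUI addnC.
apply: leq_add; first exact: sub_count.
by apply: sub_count => m /= /orP[]; apply: shattersS;
  apply/subsetP => v; rewrite inE => /andP[].
Qed.

Lemma missed_cons G x z : missed G (x :: z) = missed (zeros G x) z.
Proof.
apply/exists_inP/exists_inP => [[v Gv /= /andP[xv vz]] | [v]].
  by exists v; rewrite // inE Gv.
by rewrite inE => /andP[Gv xv] vz; exists v; rewrite //= xv.
Qed.

Lemma missed_consW G x z : missed G (x :: z) -> missed G z.
Proof. by case/exists_inP => v Gv /= /andP[_ vz]; apply/exists_inP; exists v. Qed.

(** One vertex v of G vanishing on z lies in [ones G x] for each x in N[v], hence for at least k
    letters. *)
Lemma missed_ones_sum k G z : (forall v, k <= #|CNbh T v|) ->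
  k * missed G z <= \sum_x missed (ones G x) z.
Proof.
move=> le_k; case: (boolP (missed G z)) => [/exists_inP[v Gv vz] | _]; last first.
  by rewrite muln0.
rewrite muln1 (leq_trans (le_k v)) // -sum1_card big_mkcond /=.
apply: leq_sum => x _; case: ifP => // xv.
suff -> : missed (ones G x) z by [].
by apply/exists_inP; exists v; rewrite // inE Gv.
Qed.

(** * Missed words against shattered positions *)

Definition nb_missed t G : nat := sum_words V t (fun z => missed G z).
Definition sum_shattered t G : nat := sum_words V t (nb_shattered G).

Lemma nb_missedS t G : nb_missed t.+1 G = \sum_x nb_missed t (zeros G x).
Proof.
apply: eq_bigr => x _; apply/eqP; rewrite eqn_leq.
by apply/andP; split; apply: leq_sum_words => z _; rewrite missed_cons.
Qed.

Lemma nb_missedS_le t G : nb_missed t.+1 G <= #|V| * nb_missed t G.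
Proof.
rewrite -sum_nat_const; apply: leq_sum => x _; apply: leq_sum_words => z _.
by case: (boolP (missed G (x :: z))) => // /missed_consW ->.
Qed.

Lemma nb_missed_ones k t G : (forall v, k <= #|CNbh T v|) ->
  k * nb_missed t G <= \sum_x nb_missed t (ones G x).
Proof.
move=> le_k; rewrite -sum_wordsM -sum_words_sum.
by apply: leq_sum_words => z _; apply: missed_ones_sum.
Qed.

Lemma sum_shatteredS t G :
  \sum_x sum_shattered t (ones G x) + \sum_x sum_shattered t (zeros G x)
    <= sum_shattered t.+1 G.
Proof.
rewrite -big_split /=; apply: leq_sum => x _; rewrite -sum_wordsD.
by apply: leq_sum_words => z _; apply: nb_shattered_cons.
Qed.

(* Branch on whether the classes [ones G x] carry at least a fraction k/2n of
   [sum_shattered t.+1 G].  If so, exposing one letter of the word shrinks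
   [sum_shattered] by 1 - k/2n.  If not, passing from G to the classes
   [ones G x] costs a factor n/k by [nb_missed_ones] but gains k/2n. *)
Lemma nb_missed_bound k t G : 0 < k <= #|V| -> (forall v, k <= #|CNbh T v|) ->
  (2 * #|V|) ^ t * nb_missed t G <= (2 * #|V| - k) ^ t * sum_shattered t G.
Proof.
set n := #|V|; move=> /andP[k_gt0 le_kn] le_k; elim: t G => [|t IHt] G.
  (* The only word is empty; it is missed only if G is nonempty, and then G shatters the empty
     position set. *)
  rewrite !mul1n /nb_missed /sum_shattered /= /nb_shattered /= addn0.
  case: (boolP (missed G _)) => // /exists_inP[v Gv _].
  by case: eqP Gv => // ->; rewrite inE.
have := sum_shatteredS t G.
set a := \sum_x _; set b := \sum_x _; set s := sum_shattered _ _ => le_ab.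
set P := (2 * n) ^ t; set Q := (2 * n - k) ^ t.
have le_ones : P * \sum_x nb_missed t (ones G x) <= Q * a.
  by rewrite !big_distrr; apply: leq_sum => x _; apply: IHt.
have le_zeros : P * nb_missed t.+1 G <= Q * b.
  by rewrite nb_missedS !big_distrr; apply: leq_sum => x _; apply: IHt.
rewrite !expnS -/P -/Q; have [le_a | lt_a] := leqP (2 * n * a) (k * s).
  have le_B : k * nb_missed t.+1 G <= n * \sum_x nb_missed t (ones G x).
    apply: leq_trans (nb_missed_ones _ _ _ le_k) _; rewrite big_distrr /=.
    by apply: leq_sum => x _; apply: nb_missedS_le.
  rewrite -(leq_pmul2l k_gt0).
  apply: (@leq_trans (2 * n * P * (n * \sum_x nb_missed t (ones G x)))).
    by rewrite mulnCA leq_mul2l le_B orbT.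
  apply: (@leq_trans (2 * n * n * (Q * a))).
    by rewrite -!mulnA !leq_mul2l (mulnCA P) leq_mul2l le_ones !orbT.
  apply: (@leq_trans (n * Q * (k * s))).
    have -> : 2 * n * n * (Q * a) = n * Q * (2 * n * a) by lia.
    by rewrite leq_mul2l le_a orbT.
  have -> : n * Q * (k * s) = k * (n * (Q * s)) by lia.
  rewrite -(mulnA (_ - _)) leq_mul2l leq_mul2r.
  (* Here k <= n enters, as n <= 2n - k. *)
  by apply/orP; right; apply/orP; right; lia.
(* In this branch a > (k / 2n) s, so a + b <= s leaves b at most (1 - k / 2n) s. *)
apply: (@leq_trans (2 * n * (Q * b))).
  by rewrite -mulnA leq_mul2l le_zeros orbT.
have -> : 2 * n * (Q * b) = Q * (2 * n * b) by lia.
have -> : (2 * n - k) * Q * s = Q * ((2 * n - k) * s) by lia.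
rewrite leq_mul2l mulnBl; apply/orP; right.
have : 2 * n * a + 2 * n * b <= 2 * n * s by rewrite -mulnDr leq_mul2l le_ab orbT.
by lia.
Qed.

(** * From shattered words to the VC-dimension *)

Definition realizes (Y : {set V}) w (v : V) : bool :=
  all (fun x => if x \in Y then x \in CNbh T v else x \notin clNbh v) w.

Lemma shatters_realizes G w (Y : {set V}) :
  shatters G w -> exists2 v, v \in G & realizes Y w v.
Proof.
elim: w G => [|x w IHw] G /=; first by case/set0Pn => v Gv; exists v.
case/andP => sh1 sh0; case: (boolP (x \in Y)) => xY.
  by have [v] := IHw _ sh1; rewrite inE => /andP[Gv xv] ?; exists v; rewrite ?xv.
by have [v] := IHw _ sh0; rewrite inE => /andP[Gv xv] ?; exists v; rewrite ?xv.
Qed.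

(** A repeated letter x would need a vertex with value 1 at the first occurrence and 0 at the
    second; the pattern [set0] on the rest of the word exposes this. *)
Lemma shatters_uniq G w : shatters G w -> uniq w.
Proof.
elim: w G => [|x w IHw] G //= /andP[sh1 sh0]; rewrite (IHw _ sh1) andbT.
apply/negP => xw; have [v] := shatters_realizes _ _ set0 sh1.
rewrite !inE => /andP[_ xv] /allP /(_ _ xw).
by rewrite !inE negb_or xv.
Qed.

Lemma realizes_trace w (Y : {set V}) v : Y \subset [set x in w] ->
  realizes Y w v -> CNbh T v :&: [set x in w] = Y.
Proof.
move=> /subsetP sYw /allP vP; apply/setP => x; rewrite in_setI [x \in [set _ in _]]inE.
case: (boolP (x \in w)) => xw; last first.
  by rewrite andbF; apply/esym/negP => /sYw; rewrite inE (negPf xw).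
rewrite andbT; have := vP _ xw; case: ifP => // _.
by rewrite in_setU negb_or => /andP[/negPf].
Qed.

Lemma realizes_not_red w (Y : {set V}) v x :
  realizes Y w v -> x \in w -> ~~ tg_R T v x.
Proof.
move=> /allP vP /vP; case: ifP => _; rewrite !inE.
  by case/orP => [/eqP-> | /tg_ER_disj //]; rewrite tg_R_irr.
by rewrite negb_or => /andP[].
Qed.

Lemma Nat_powE m n : Nat.pow m n = m ^ n.
Proof. by elim: n => //= n ->; rewrite expnS. Qed.

(** One realizer is chosen for each subset of the letters. Its trace recovers the subset, so there
    are exactly 2^|X| of them, and none is undefined on a letter, so none has a red neighbour in
    X. *)
Lemma shatters_shattered w : shatters setT w -> shattered T [set x in w].
Proof.
move=> sh; set X := [set x in w].
have ex_v Y : exists v, realizes Y w v.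
  by have [v _ vP] := shatters_realizes _ _ Y sh; exists v.
pose f Y := xchoose (ex_v Y).
have fP Y : realizes Y w (f Y) by apply: xchooseP.
apply/existsP; exists (f @: powerset X); apply/and3P; split.
- rewrite card_in_imset ?card_powerset ?Nat_powE // => Y Y'.
  rewrite !powersetE => sYX sY'X eqf.
  by rewrite -(realizes_trace _ _ _ sYX (fP Y)) eqf (realizes_trace _ _ _ sY'X (fP Y')).
- apply/forall_inP => v /imsetP[Y _ ->]; apply/forall_inP => x; rewrite inE => xw.
  exact: realizes_not_red (fP Y) xw.
- apply/forallP => Y; apply/implyP => sYX; apply/exists_inP; exists (f Y).
    by rewrite imset_f ?powersetE.
  by rewrite (realizes_trace _ _ _ sYX).
Qed.

Lemma size_shatters w : shatters setT w -> size w <= vc_dim T.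
Proof.
move=> sh; have -> : size w = #|[set x in w]|.
  by rewrite cardsE; apply/esym/card_uniqP; apply: shatters_uniq sh.
exact: (leq_bigmax_cond (F := fun X : {set V} => #|X|) _ (shatters_shattered _ sh)).
Qed.

Lemma nb_shattered_bound d z : vc_dim T <= d ->
  nb_shattered setT z <= small_masks (size z) d.
Proof.
move=> le_vc; pose P (m : bitseq) := (size m == size z) && shatters setT (mask m z).
rewrite /nb_shattered (@eq_in_count _ _ P) => [|m /size_bitmasks sz]; last first.
  by rewrite /P sz eqxx.
apply: sub_count => m /= /andP[/eqP sz /size_shatters].
by rewrite size_mask // => /leq_trans; apply.
Qed.

(** * Words too short to dominate *)

Lemma missed_of_small_words t z :
  size z <= t -> t < domination_number T -> missed setT z.
Proof.
move=> sz lt_t; apply/contraT => not_missed.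
suff /(leq_trans lt_t) : domination_number T <= t by rewrite ltnn.
apply: leq_trans sz; apply: leq_trans (card_size z); rewrite -cardsE.
apply: bigminn_le_cond; first by rewrite mem_index_enum.
apply/forallP => y; apply: contraR not_missed => /exists_inPn yP.
apply/exists_inP; exists y => //; apply/allP => x xz.
have := yP x; rewrite inE xz => /(_ isT).
by rewrite !inE eq_sym tg_E_sym tg_R_sym.
Qed.

(** All n^t words miss a vertex, while each has at most [small_masks t d] shattered position sets;
    the common factor n^t cancels in [nb_missed_bound]. *)
Lemma domination_counting k d t :
  0 < k <= #|V| -> (forall v, k <= #|CNbh T v|) ->
  vc_dim T <= d -> t < domination_number T ->
  (2 * #|V|) ^ t <= (2 * #|V| - k) ^ t * small_masks t d.
Proof.
move=> kn le_k le_vc lt_t; have V_gt0 : 0 < #|V| by lia.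
have le_missed : #|V| ^ t <= nb_missed t setT.
  rewrite -[_ ^ _]muln1 -sum_words_const; apply: leq_sum_words => z sz.
  by rewrite (missed_of_small_words t) ?sz.
have le_sh : sum_shattered t setT <= #|V| ^ t * small_masks t d.
  rewrite -sum_words_const; apply: leq_sum_words => z sz.
  by rewrite -sz; apply: nb_shattered_bound.
have n_gt0 : 0 < #|V| ^ t by rewrite expn_gt0 V_gt0.
rewrite -(leq_pmul2r n_gt0).
apply: (@leq_trans ((2 * #|V|) ^ t * nb_missed t setT)).
  by rewrite leq_mul2l le_missed orbT.
apply: leq_trans (nb_missed_bound k t setT kn le_k) _.
by rewrite -mulnA leq_mul2l [small_masks _ _ * _]mulnC le_sh orbT.
Qed.

End PartialClass.

(** * Logarithmic estimates and the constant *)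

Lemma ln_le (x y : R) : (0 < x)%R -> (x <= y)%R -> (ln x <= ln y)%R.
Proof.
by move=> x0 [/(ln_increasing _ _ x0) | ->]; [apply: Rlt_le | apply: Rle_refl].
Qed.

Lemma ln_div (x y : R) : (0 < x)%R -> (0 < y)%R -> (ln (x / y) = ln x - ln y)%R.
Proof.
move=> x0 y0; rewrite /Rdiv ln_mult ?ln_Rinv //; exact: Rinv_0_lt_compat.
Qed.

Lemma INR_expn (m t : nat) : INR (m ^ t) = (INR m ^ t)%R.
Proof. by elim: t => [|t IHt] //; rewrite expnS mult_INR IHt. Qed.

(* Taking x = delta / 4 in [small_masks_bound] makes the two exponential factors
   combine to (1 - delta / 2) (1 + delta / 4) <= exp (- delta / 4). *)
Lemma counting_bound (delta : R) (n k d t : nat) :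
  (0 < delta <= 1)%R -> 0 < n -> k <= n -> (delta * INR n <= INR k)%R ->
  (2 * n) ^ t <= (2 * n - k) ^ t * small_masks t d ->
  (INR t <= 8 * (INR d / delta) * ln (2 / delta))%R.
Proof.
move=> d01 n_gt0 le_kn le_k le_t.
have n_pos : (0 < INR n)%R by apply: lt_0_INR; lia.
have /(le_INR _ _) : ((2 * n) ^ t <= (2 * n - k) ^ t * small_masks t d)%coq_nat by lia.
rewrite mult_INR !INR_expn minus_INR ?mult_INR; last by lia.
have -> : INR 2 = 2%R by [].
move=> le_R.
have x01 : (0 < delta / 4 <= 1)%R by lra.
have le_sm := small_masks_bound (delta / 4) t d x01.
have xd_pos : (0 < (delta / 4) ^ d)%R by apply: pow_lt; lra.
set c := (2 * INR n)%R in le_R.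
have ct_pos : (0 < c ^ t)%R by apply: pow_lt; rewrite /c; lra.
have le_kn_R : (INR k <= INR n)%R by apply: le_INR; lia.
have le_base : ((c - INR k) * (1 + delta / 4) <= c * exp (- (delta / 4)))%R.
  have e1 := exp_ineq1_le (- (delta / 4)).
  apply: (Rle_trans _ (c * (1 - delta / 4))); last first.
    by apply: Rmult_le_compat_l; rewrite /c; lra.
  apply: (Rle_trans _ (c * (1 - delta / 2) * (1 + delta / 4))).
    by apply: Rmult_le_compat_r; rewrite /c; lra.
  rewrite Rmult_assoc; apply: Rmult_le_compat_l; first by rewrite /c; lra.
  have : (0 <= delta * delta)%R by apply: Rmult_le_pos; lra.
  by lra.
have le_pow : ((delta / 4) ^ d <= exp (- (delta / 4)) ^ t)%R.
  apply: (Rmult_le_reg_l (c ^ t)) => //.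
  apply: (Rle_trans _ ((c - INR k) ^ t * INR (small_masks t d) * (delta / 4) ^ d)).
    by apply: Rmult_le_compat_r => //; lra.
  apply: (Rle_trans _ ((c - INR k) ^ t * (1 + delta / 4) ^ t)).
    rewrite Rmult_assoc; apply: Rmult_le_compat_l => //.
    by apply: pow_le; rewrite /c; lra.
  rewrite -!Rpow_mult_distr; apply: pow_incr; split => //.
  by apply: Rmult_le_pos; rewrite /c; lra.
have := ln_le _ _ xd_pos le_pow.
rewrite !ln_pow; [|exact: exp_pos|lra]; rewrite ln_exp => le_ln.
have -> : ln (2 / delta) = (ln 2 - ln delta)%R by rewrite ln_div; lra.
have ln4 : ln 4 = (2 * ln 2)%R.
  by rewrite (_ : 4 = 2 * 2)%R ?ln_mult; lra.
rewrite ln_div ?ln4 in le_ln; try lra.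
have ln_d : (ln delta <= 0)%R by rewrite -ln_1; apply: ln_le; lra.
(* So far t delta / 4 <= d ln (4 / delta); the factor 8 comes from ln (4 / delta) <= 2 ln (2 /
   delta), valid as delta <= 1. *)
apply: (Rmult_le_reg_l (delta / 4)); first lra.
have -> : (delta / 4 * (8 * (INR d / delta) * (ln 2 - ln delta)) =
  INR d * (2 * (ln 2 - ln delta)))%R by field; lra.
apply: (Rle_trans _ (INR d * (2 * ln 2 - ln delta))); first by lra.
by apply: Rmult_le_compat_l; [exact: pos_INR | lra].
Qed.

Theorem theorem1p6 :
  exists C : R, (0 < C)%R /\
    forall (delta : R) (d : nat), (0 < delta <= 1)%R -> (1 <= d)%N ->
    forall (V : finType) (T : trigraph V),
      (delta * INR #|V| <= INR (min_degree T))%R ->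
      (vc_dim T <= d)%N ->
      (INR (domination_number T) <= C * (INR d / delta) * ln (2 / delta))%R.
Proof.
(* The count is applied to t = gamma - 1 and gives gamma <= 8 Q + 1; since Q >= 1/2, the extra 1 is
   at most 2 Q. *)
exists 10%R; split; first lra.
move=> delta d d01 d_ge1 V T le_deg le_vc.
set Q := (INR d / delta * ln (2 / delta))%R.
have Q_ge : (1 / 2 <= Q)%R.
  have ln2 := ln_lt_2.
  have le_ln : (ln 2 <= ln (2 / delta))%R.
    by apply: ln_le; [lra | apply: (Rmult_le_reg_r delta); [lra | field_simplify; lra]].
  have d_R : (1 <= INR d)%R by apply: (le_INR 1); lia.
  have le_d : (1 <= INR d / delta)%R.
    by apply: (Rmult_le_reg_r delta); first lra; field_simplify; lra.
  rewrite /Q; apply: (Rle_trans _ (1 * ln (2 / delta))); first lra.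
  by apply: Rmult_le_compat_r; lra.
case def_t: (domination_number T) => [|t]; first by rewrite /Q in Q_ge; simpl; lra.
(* The default value [#|V|] of the minimum bounds gamma, so gamma > 0 yields a vertex. *)
have V_gt0 : 0 < #|V|.
  by apply: (@leq_trans t.+1) => //; rewrite -def_t; apply: bigminn_le_idx.
have n_pos : (0 < INR #|V|)%R by apply: lt_0_INR; lia.
have k_gt0 : 0 < min_degree T.
  suff : (0 < INR (min_degree T))%R by move/(INR_lt 0); lia.
  by have := Rmult_lt_0_compat delta _ (proj1 d01) n_pos; lra.
have le_k v : min_degree T <= #|CNbh T v|.
  apply: (@leq_trans #|Nbh T v|); last exact/subset_leq_card/subsetUr.
  by apply: bigminn_le_cond; rewrite ?mem_index_enum.
have le_kn : min_degree T <= #|V| by apply: bigminn_le_idx.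
have kn : 0 < min_degree T <= #|V| by rewrite k_gt0.
have lt_t : t < domination_number T by rewrite def_t.
have := counting_bound _ _ _ _ _ d01 V_gt0 le_kn le_deg
  (domination_counting _ T _ _ _ kn le_k le_vc lt_t).
rewrite S_INR; rewrite /Q in Q_ge; lra.
Qed.
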